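(* Let $\mathcal C=\mathcal C(I,\mathcal X,r,(A^X)_{X\in\mathcal X})$ be a non-sporadic finite Cartan graph of rank $r\ge5$. Then exactly one of the following two alternatives holds: (1) $\mathcal C$ is standard of type $A_r$, $B_r$, $C_r$ or $D_r$. (2) Up to equivalence, there exists a point $Y\in\mathcal X$ such that $Y$ has a good $D'_r$ neighborhood.
   Context: Semi-Cartan graphs. A generalized Cartan matrix is an integer matrix $A=(a_{ij})_{i,j\in I}$ with $a_{ii}=2$, $a_{jk}\le0$ for $j\ne k$, and $a_{ij}=0\Rightarrow a_{ji}=0$. A semi-Cartan graph $\mathcal C(I,\mathcal X,r,(A^X)_{X\in\mathcal X})$ consists of $I=\{1,\dots,r\}$ ($r$ is the rank), a nonempty set $\mathcal X$ of points, maps $r_i:\mathcal X\to\mathcal X$ ($i\in I$) with $r_i^2=\mathrm{id}$, and generalized Cartan matrices $A^X=(a^X_{ij})$ with $a_{ij}^X=a_{ij}^{r_i(X)}$ for all $i,j,X$. It is connected if no proper nonempty subset of $\mathcal X$ is stable under all $r_i$; all graphs here are connected. Let $\alpha_1,\dots,\alpha_r$ be the standard basis of $\mathbb Z^I$ and $s_i^X\in\mathrm{Aut}(\mathbb Z^I)$, $s_i^X\alpha_j=\alpha_j-a_{ij}^X\alpha_i$, regarded as a morphism $X\to r_i(X)$ of a groupoid with object set $\mathcal X$ generated by these morphisms. The set of real roots at $X$ is $\boldsymbol\Delta^{X\,\mathrm{re}}=\{\omega\alpha_i\mid i\in I,\ \omega \text{ a morphism with target }X\}$; the positive real roots are those in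 $\mathbb N_0^I$. $\mathcal C$ is finite if all $\boldsymbol\Delta^{X\,\mathrm{re}}$ are finite. $\mathcal C$ is a Cartan graph if for every $X$ each real root lies in $\mathbb N_0^I\cup-\mathbb N_0^I$, and $(r_ir_j)^{m_{ij}^X}(X)=X$ whenever $m_{ij}^X=|\boldsymbol\Delta^{X\,\mathrm{re}}\cap(\mathbb N_0\alpha_i+\mathbb N_0\alpha_j)|$ is finite. $\mathcal C$ is standard if $A^X=A^Y$ for all $X,Y\in\mathcal X$; it is standard of type $T$ if this common matrix is, up to a permutation of $I$, the Cartan matrix of type $T$. Equivalence of Cartan graphs means bijections of the index sets and of the point sets compatible with the maps $r_i$ and the Cartan matrices. Non-sporadic. Put $\eta_{i,j}=\sum_{k=i}^j\alpha_k$ for $i\le j$ and $\eta_{i,j}=0$ for $i>j$. For $Z\subseteq\{1,\dots,r-1\}$ let $\Phi_{r,Z}$ be the set of: $\eta_{i,j-1}$ ($1\le i<j\le r$); $\eta_{i,r-2}+\alpha_r$ ($1\le i<r$); $\eta_{i,r}+\eta_{j,r-2}$ ($1\le i<j<r$); $\eta_{j,r}+\eta_{j,r-2}$ ($j\in Z$). For $Y\subseteq\{1,\dots,r-1\}$ let $\Psi_{r,Y}$ be the set of: $\eta_{i,j}$ ($1\le i\le j\le r$); $\eta_{i,r}+\eta_{j,r-1}$ ($1\le i<j<r$); $\eta_{j,r}+\eta_{j,r-1}$ ($j\in Y$). ($\Phi_{r,\emptyset}$ and $\Psi_{r,\{1,\dots,r-1\}}$ are the positive roots of types $D_r$ and $C_r$.)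 For rank $r\ge5$, a connected finite Cartan graph is non-sporadic if, after a permutation of $I$, the set of positive real roots at some point is the set of positive roots of the classical root system $A_r$ or $B_r$, or equals some $\Phi_{r,Z}$ or some $\Psi_{r,Y}$. Good $D'_r$ neighborhood. A point $X$ has a good $D'_r$ neighborhood if, after a suitable permutation of $I$, there is $a\in\{1,2\}$ such that: - $A^X=A^{r_i(X)}$ for all $i\in\{1,4,5,\dots,r\}$; - $A^{r_2(X)}$ has diagonal entries $2$, off-diagonal entries $-1$ at positions $(1,2),(2,1),(1,3),(3,1),(2,3),(3,2)$ and $(i,i+1),(i+1,i)$ for $3\le i\le r-1$, and all other entries $0$; - $A^{r_3(X)}$ has diagonal entries $2$, entry $-1$ at $(1,2)$, entry $-a$ at $(2,1)$, entries $-1$ at $(i,i+1),(i+1,i)$ for $2\le i\le r-1$, and all other entries $0$; - $a_{14}^{r_3r_2(X)}=0$, where $r_3r_2(X)=r_3(r_2(X))$. *)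

(* Defs.v *)
From HB Require Import structures.
From mathcomp Require Import all_boot all_order all_fingroup all_algebra.
From mathcomp Require Import boolp classical_sets functions cardinality.

Set Implicit Arguments.
Unset Strict Implicit.
Unset Printing Implicit Defensive.

Import Order.TTheory GRing.Theory Num.Theory.

Local Open Scope classical_set_scope.
Local Open Scope ring_scope.

(* The index set I = {1, ..., r} is 'I_r: the ordinal i : 'I_r stands for the
   index i.+1. Explicit formulas take 1-based indices in nat. *)

Definition is_GCM (r : nat) (A : 'M[int]_r) : Prop :=
  [/\ forall i, A i i = 2,
      forall j k, j != k -> A j k <= 0 &
      forall i j, A i j = 0 -> A j i = 0].

Record semi_cartan_graph (r : nat) := SemiCartanGraph {
  point : Type;
  point_inhabited : inhabited point;
  refl : 'I_r -> point -> point;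
  reflK : forall i, involutive (refl i);
  cartan : point -> 'M[int]_r;
  cartan_GCM : forall X, is_GCM (cartan X);
  cartan_refl : forall i j X, cartan X i j = cartan (refl i X) i j
}.

Definition graph_connected (r : nat) (C : semi_cartan_graph r) : Prop :=
  forall S : set (point C), S !=set0 ->
    (forall i X, S X -> S (refl i X)) -> S = setT.

(* Elements of Z^I are column vectors, endomorphisms are matrices acting on the
   left. *)
Definition alpha (r : nat) (i : 'I_r) : 'cV[int]_r := delta_mx i 0.

Definition simple_refl (r : nat) (C : semi_cartan_graph r) (i : 'I_r)
    (X : point C) : 'M[int]_r :=
  \matrix_(k, j) (alpha j - cartan X i j *: alpha i) k 0.

(* weyl_hom X Y w: the matrix w is a morphism X -> Y of the groupoid. *)
Inductive weyl_hom (r : nat) (C : semi_cartan_graph r) :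
    point C -> point C -> 'M[int]_r -> Prop :=
| weyl_hom_gen i X : weyl_hom X (refl i X) (simple_refl i X)
| weyl_hom_id X : weyl_hom X X 1%:M
| weyl_hom_comp X Y Z u v :
    weyl_hom X Y u -> weyl_hom Y Z v -> weyl_hom X Z (v *m u)
| weyl_hom_inv X Y u : weyl_hom X Y u -> weyl_hom Y X (invmx u).

Definition real_roots (r : nat) (C : semi_cartan_graph r) (X : point C) :
    set 'cV[int]_r :=
  [set b | exists (Y : point C) (w : 'M[int]_r) (i : 'I_r),
     weyl_hom Y X w /\ b = w *m alpha i].

Definition nonneg_vec (r : nat) : set 'cV[int]_r :=
  [set b | forall i, 0 <= b i 0].

Definition pos_real_roots (r : nat) (C : semi_cartan_graph r) (X : point C) :
    set 'cV[int]_r :=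
  real_roots X `&` @nonneg_vec r.

Definition cone2 (r : nat) (i j : 'I_r) : set 'cV[int]_r :=
  [set b | exists m n : nat, b = alpha i *+ m + alpha j *+ n].

Definition graph_finite (r : nat) (C : semi_cartan_graph r) : Prop :=
  forall X : point C, finite_set (real_roots X).

Definition cartan_graph (r : nat) (C : semi_cartan_graph r) : Prop :=
  (forall X : point C, forall b, real_roots X b ->
     nonneg_vec b \/ nonneg_vec (- b)) /\
  (forall (X : point C) (i j : 'I_r) (m : nat),
     (real_roots X `&` cone2 i j #= `I_m)%card ->
     iter m (fun Y => refl i (refl j Y)) X = X).

Definition standard (r : nat) (C : semi_cartan_graph r) : Prop :=
  forall X Y : point C, cartan X = cartan Y.

Definition standard_of_type (r : nat) (T : 'M[int]_r)
    (C : semi_cartan_graph r) : Prop :=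
  standard C /\
  exists s : {perm 'I_r}, forall X : point C, mxsub s s (cartan X) = T.

Definition equivalent (r : nat) (C D : semi_cartan_graph r) : Prop :=
  exists (s : {perm 'I_r}) (f : point C -> point D),
    [/\ bijective f,
        forall i X, f (refl i X) = refl (s i) (f X) &
        forall X i j, cartan (f X) (s i) (s j) = cartan X i j].

Lemma mxsub_GCM (r : nat) (s : {perm 'I_r}) (A : 'M[int]_r) :
  is_GCM A -> is_GCM (mxsub s s A).
Proof.
case=> A2 Ale A0; split=> [i|j k njk|i j]; rewrite !mxE //.
- by apply: Ale; rewrite (inj_eq perm_inj).
- exact: A0.
Qed.

Lemma mxsub_cartan_refl (r : nat) (s : {perm 'I_r}) (C : semi_cartan_graph r)
    i j (X : point C) :
  mxsub s s (cartan X) i j = mxsub s s (cartan (refl (s i) X)) i j.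
Proof. by rewrite !mxE cartan_refl. Qed.

(* C after the permutation s of I: the index i now plays the role of s i. *)
Definition relabel (r : nat) (s : {perm 'I_r}) (C : semi_cartan_graph r) :
    semi_cartan_graph r :=
  SemiCartanGraph (point_inhabited C) (fun i => @reflK r C (s i))
    (fun X => mxsub_GCM s (cartan_GCM X)) (@mxsub_cartan_refl r s C).

Definition mx1 (r : nat) (f : nat -> nat -> int) : 'M[int]_r :=
  \matrix_(i, j) f i.+1 j.+1.

Definition adjacent (p q : nat) : bool := (q == p.+1) || (p == q.+1).

(* As s_i alpha_j = alpha_j - a_ij alpha_i, the last simple root is short in
   type B_r, where a_(r, r-1) = -2, and long in type C_r, where
   a_(r-1, r) = -2. *)
Definition cartanA (r : nat) : 'M[int]_r := mx1 r (fun p q =>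
  if p == q then 2 else if adjacent p q then -1 else 0).

Definition cartanB (r : nat) : 'M[int]_r := mx1 r (fun p q =>
  if p == q then 2 else if (p, q) == (r, r.-1) then -2
  else if adjacent p q then -1 else 0).

Definition cartanC (r : nat) : 'M[int]_r := mx1 r (fun p q =>
  if p == q then 2 else if (p, q) == (r.-1, r) then -2
  else if adjacent p q then -1 else 0).

Definition cartanD (r : nat) : 'M[int]_r := mx1 r (fun p q =>
  if p == q then 2
  else if (p, q) \in [:: (r.-2, r); (r, r.-2)] then -1
  else if [&& p < r, q < r & adjacent p q]%N then -1 else 0).

(* eta r i j is alpha_i + ... + alpha_j for 1 <= i <= j <= r and 0 for i > j;
   in particular eta r i i is alpha_i. *)
Definition eta (r i j : nat) : 'cV[int]_r :=
  \col_(k < r) ((i <= k.+1 <= j)%N)%:R.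

Definition pos_rootsA (r : nat) : set 'cV[int]_r :=
  [set b | exists i j : nat, (1 <= i <= j)%N /\ (j <= r)%N /\ b = eta r i j].
Arguments pos_rootsA : clear implicits.

Definition pos_rootsB (r : nat) : set 'cV[int]_r :=
  pos_rootsA r `|`
  [set b | exists i j : nat,
     (1 <= i < j)%N /\ (j <= r)%N /\ b = eta r i r + eta r j r].
Arguments pos_rootsB : clear implicits.

Definition Phi (r : nat) (Z : {pred nat}) : set 'cV[int]_r :=
  [set b | exists i j : nat,
     (1 <= i < j)%N /\ (j <= r)%N /\ b = eta r i j.-1] `|`
  [set b | exists i : nat,
     (1 <= i < r)%N /\ b = eta r i r.-2 + eta r r r] `|`
  [set b | exists i j : nat,
     (1 <= i < j)%N /\ (j < r)%N /\ b = eta r i r + eta r j r.-2] `|`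
  [set b | exists j : nat, j \in Z /\ b = eta r j r + eta r j r.-2].
Arguments Phi : clear implicits.

Definition Psi (r : nat) (Y : {pred nat}) : set 'cV[int]_r :=
  [set b | exists i j : nat, (1 <= i <= j)%N /\ (j <= r)%N /\ b = eta r i j] `|`
  [set b | exists i j : nat,
     (1 <= i < j)%N /\ (j < r)%N /\ b = eta r i r + eta r j r.-1] `|`
  [set b | exists j : nat, j \in Y /\ b = eta r j r + eta r j r.-1].
Arguments Psi : clear implicits.

Definition non_sporadic (r : nat) (C : semi_cartan_graph r) : Prop :=
  exists (s : {perm 'I_r}) (X : point (relabel s C)),
    [\/ pos_real_roots X = pos_rootsA r,
        pos_real_roots X = pos_rootsB r,
        exists2 Z : {pred nat},
          {subset Z <= [pred j | 1 <= j < r]%N} & pos_real_roots X = Phi r Z |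
        exists2 Y : {pred nat},
          {subset Y <= [pred j | 1 <= j < r]%N} & pos_real_roots X = Psi r Y].

Definition triangle_mx (r : nat) : 'M[int]_r := mx1 r (fun p q =>
  if p == q then 2
  else if (p, q) \in [:: (1, 2); (2, 1); (1, 3); (3, 1); (2, 3); (3, 2)]%N
  then -1
  else if [&& 3 <= p, 3 <= q & adjacent p q]%N then -1 else 0).

Definition chain_mx (r : nat) (a : int) : 'M[int]_r := mx1 r (fun p q =>
  if p == q then 2
  else if (p, q) == (1, 2)%N then -1
  else if (p, q) == (2, 1)%N then - a
  else if [&& 2 <= p, 2 <= q & adjacent p q]%N then -1 else 0).

(* i1, i2, i3, i4 are the indices 1, 2, 3, 4 of I. *)
Definition labelled_good_D'_neighborhood (r : nat) (C : semi_cartan_graph r)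
    (X : point C) : Prop :=
  exists i1 i2 i3 i4 : 'I_r,
    [/\ i1.+1 = 1%N, i2.+1 = 2%N, i3.+1 = 3%N & i4.+1 = 4%N] /\
    exists a : int,
      [/\ a = 1 \/ a = 2,
          forall i : 'I_r, i != i2 -> i != i3 -> cartan X = cartan (refl i X),
          cartan (refl i2 X) = triangle_mx r,
          cartan (refl i3 X) = chain_mx r a &
          cartan (refl i3 (refl i2 X)) i1 i4 = 0].

Definition good_D'_neighborhood (r : nat) (C : semi_cartan_graph r)
    (X : point C) : Prop :=
  exists s : {perm 'I_r},
    @labelled_good_D'_neighborhood r (relabel s C) X.

(* Main.v *)
(* All the root sets in question become standard in orthonormal coordinates:
   Phi_(r,Z) and Psi_(r,Y) are the positive roots of D_r together with the
   vectors 2 e_j and -2 e_j for j in a set S of indices (S = Z, resp. S is Y with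
   r added), written in a basis of simple roots of type D if r is not in S and of
   type C if r is in S. Crossing a wall either permutes or negates coordinates,
   which changes S by a transposition, or, for the wall of e_(r-1) - e_r when
   exactly one of r - 1 and r is in S, also exchanges the two kinds of basis.
   Types A_r and B_r and the cases of empty or full S are invariant under all
   these moves, so the graph is standard. Otherwise one moves an index of S (or
   one outside S) to position r - 1 and reaches a point of type C with r - 1 not
   in S; numbering the indices backwards, its neighborhood is a good D'_r one. *)
From mathcomp Require Import all_boot all_order all_fingroup all_algebra.
From mathcomp Require Import zify ring boolp classical_sets.
Require Import Defs.

Set Implicit Arguments.
Unset Strict Implicit.
Unset Printing Implicit Defensive.
Import Order.TTheory GRing.Theory Num.Theory.

(** * Real roots and root strings in the groupoid of a semi-Cartan graph *)

Section Groupoid.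
Local Open Scope ring_scope.
Variables (r : nat) (C : semi_cartan_graph r).
Implicit Types (X Y : point C) (i j : 'I_r) (b : 'cV[int]_r).

Lemma simple_reflE i X b :
  simple_refl i X *m b = b - (\sum_j cartan X i j * b j 0) *: alpha i.
Proof.
apply/matrixP=> k l; rewrite (ord1 l) !mxE.
transitivity (\sum_j ((k == j)%:R * b j 0 - cartan X i j * b j 0 * (k == i)%:R)).
  apply: eq_bigr => j _; rewrite !mxE eqxx !andbT mulrBl; congr (_ - _).
  by rewrite mulrAC.
rewrite sumrB -mulr_suml eqxx andbT; congr (_ - _).
rewrite (bigD1 k) //= eqxx mul1r big1 ?addr0 // => j /negbTE njk.
by rewrite eq_sym njk mul0r.
Qed.

Lemma cartan_diag X i : cartan X i i = 2.
Proof. by case: (cartan_GCM X). Qed.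

Lemma simple_refl_alpha i j X :
  simple_refl i X *m alpha j = alpha j - cartan X i j *: alpha i.
Proof.
rewrite simple_reflE; congr (_ - _ *: _).
rewrite (bigD1 j) //= !mxE !eqxx mulr1 big1 ?addr0 // => k /negbTE nkj.
by rewrite mxE nkj mulr0.
Qed.

Lemma simple_refl_point i X : simple_refl i (refl i X) = simple_refl i X.
Proof. by apply/matrixP=> k j; rewrite !mxE -cartan_refl. Qed.

Lemma simple_reflK i X : simple_refl i X *m simple_refl i X = 1%:M.
Proof.
apply/matrixP => k l.
have colE (M : 'M[int]_r) : M k l = (M *m alpha l) k 0.
  rewrite !mxE (bigD1 l) //= !mxE !eqxx mulr1 big1 ?addr0 // => j /negbTE njl.
  by rewrite mxE njl mulr0.
rewrite colE -mulmxA simple_refl_alpha mulmxBr -scalemxAr !simple_refl_alpha.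
by rewrite cartan_diag [RHS]colE mul1mx !mxE; ring.
Qed.

Lemma weyl_hom_unit X Y w : weyl_hom X Y w -> w \in unitmx.
Proof.
elim=> [i Z|Z|Z Z' Z'' u v _ uu _ uv|Z Z' u _ uu].
- by have /mulmx1_unit[] := simple_reflK i Z.
- exact: unitmx1.
- by rewrite unitmx_mul uu uv.
- by rewrite unitmx_inv.
Qed.

Lemma real_root_alpha X i : real_roots X (alpha i).
Proof. by exists X, 1%:M, i; split; [exact: weyl_hom_id | rewrite mul1mx]. Qed.

Lemma real_roots_refl X i b :
  real_roots (refl i X) b <-> real_roots X (simple_refl i X *m b).
Proof.
have imp (Z : point C) c :
    real_roots Z c -> real_roots (refl i Z) (simple_refl i Z *m c).
  move=> [Y [w [j [hw ->]]]]; exists Y, (simple_refl i Z *m w), j.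
  by split; [exact: weyl_hom_comp hw (weyl_hom_gen i Z) | rewrite mulmxA].
split=> [/imp|/imp]; first by rewrite reflK simple_refl_point.
by rewrite mulmxA simple_reflK mul1mx.
Qed.

Lemma real_roots_opp X b : real_roots X b -> real_roots X (- b).
Proof.
move=> [Y [w [j [hw ->]]]]; exists (refl j Y), (w *m simple_refl j (refl j Y)), j.
split.
  have := weyl_hom_comp (weyl_hom_gen j (refl j Y)); rewrite reflK; exact.
rewrite -mulmxA simple_refl_alpha cartan_diag scaler_nat mulr2n.
by rewrite opprD addrA subrr add0r mulmxN.
Qed.

Lemma real_root_cartan X i j :
  real_roots X (alpha j - cartan X i j *: alpha i).
Proof.
rewrite -simple_refl_alpha; apply/real_roots_refl; exact: real_root_alpha.
Qed.

Definition sign_coherent (D : set 'cV[int]_r) : Prop :=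
  forall b, D b -> nonneg_vec b \/ nonneg_vec (- b).

Lemma sign_coherent_string D i j (k : int) : sign_coherent D -> i != j ->
  D (alpha j + k *: alpha i) -> 0 <= k.
Proof.
move=> cohD nij /cohD [/(_ i)|/(_ j)].
  by rewrite !mxE !eqxx (negbTE nij) add0r mulr1.
by rewrite !mxE !eqxx eq_sym (negbTE nij) mulr0 addr0.
Qed.

Hypothesis cohC : forall X, sign_coherent (real_roots X).

(** Reflection in alpha_i reverses the alpha_i-string through alpha_j: k becomes -a_ij - k, which
    sign coherence at r_i(X) makes nonnegative. With [real_root_cartan], -a_ij is thus the largest
    coefficient in the string. *)
Lemma cartan_string_max X i j (k : int) : i != j ->
  real_roots X (alpha j + k *: alpha i) -> k <= - cartan X i j.
Proof.
move=> nij h; have : real_roots (refl i X)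
    (alpha j + (- cartan X i j - k) *: alpha i).
  apply/real_roots_refl; rewrite mulmxDr -scalemxAr !simple_refl_alpha.
  rewrite cartan_diag [X in real_roots _ X](_ : _ = alpha j + k *: alpha i) //.
  by apply/matrixP=> x y; rewrite !mxE; ring.
by move=> /(sign_coherent_string (cohC (X:=_)) nij); rewrite subr_ge0.
Qed.

(** Cartan entries are string lengths, so an involution of I that preserves strings preserves the
    matrix. It supplies the one row of a type D point that is not found by crossing its own wall. *)
Lemma cartan_symm X (t : 'I_r -> 'I_r) : involutive t ->
  (forall i j (k : int), real_roots X (alpha j + k *: alpha i) ->
     real_roots X (alpha (t j) + k *: alpha (t i))) ->
  forall i j, cartan X (t i) (t j) = cartan X i j.
Proof.
move=> tK symX; have le i j : i != j -> cartan X (t i) (t j) <= cartan X i j.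
  move=> nij; rewrite -lerN2; apply: cartan_string_max.
    by rewrite (inj_eq (inv_inj tK)).
  by apply: symX; rewrite scaleNr; exact: real_root_cartan.
move=> i j; have [<-|nij] := eqVneq i j; first by rewrite !cartan_diag.
apply/eqP; rewrite eq_le le //= -{1}(tK i) -{1}(tK j) le //.
by rewrite (inj_eq (inv_inj tK)).
Qed.

(* A linear form L whose reflection b |-> b - L(b) alpha_i carries the real
   roots at X onto some sign coherent set containing the simple roots has to be
   the i-th row of the Cartan matrix: both rows give the length of the
   alpha_i-string through alpha_j. *)
Lemma cartan_row_unique X i (L : 'cV[int]_r -> int) (D : set 'cV[int]_r) :
  (forall k b c, L (k *: b + c) = k * L b + L c) -> L (alpha i) = 2 ->
  sign_coherent D -> (forall j, D (alpha j)) ->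
  (forall b, real_roots X b <-> D (b - L b *: alpha i)) ->
  (forall j, cartan X i j = L (alpha j)) /\
  (forall b, real_roots (refl i X) b <-> D b).
Proof.
move=> linL Li cohD simD XD.
have string j (k : int) : alpha j + k *: alpha i -
    L (alpha j + k *: alpha i) *: alpha i =
    alpha j + (- L (alpha j) - k) *: alpha i.
  have -> : L (alpha j + k *: alpha i) = k * 2 + L (alpha j).
    by rewrite addrC linL Li.
  by apply/matrixP=> x y; rewrite !mxE; ring.
have rowE j : cartan X i j = L (alpha j).
  have [<-|nij] := eqVneq i j; first by rewrite cartan_diag Li.
  (* The string member with k = -L(alpha_j) reflects to alpha_j, which lies in D; the converse bound
     comes from reflecting the real root with k = -a_ij into D. *)
  apply/eqP; rewrite eq_le -[X in X && _]lerN2; apply/andP; split.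
    apply: (cartan_string_max nij); apply/XD.
    by rewrite string subrr scale0r addr0.
  have /XD := real_root_cartan X i j; rewrite -scaleNr string.
  by move=> /(sign_coherent_string cohD nij); rewrite opprK addrC subr_ge0.
split=> // b.
have L0 : L 0 = 0 by have := linL (-1) 0 0; rewrite scaler0 addr0; lia.
have LE c : L c = \sum_j cartan X i j * c j 0.
  rewrite {1}(matrix_sum_delta c).
  under eq_bigr => j _ do rewrite big_ord1.
  elim/big_ind2: _ => // [x u y v <- <-|j _].
    by rewrite -[u]scale1r linL mul1r scale1r.
  by rewrite -[_ *: _]addr0 linL L0 addr0 rowE mulrC.
have reflE c : simple_refl i X *m c = c - L c *: alpha i.
  by rewrite simple_reflE LE.
by rewrite real_roots_refl XD -reflE mulmxA simple_reflK mul1mx.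
Qed.

End Groupoid.

(** * Classical root sets in orthonormal coordinates *)

Section Coordinates.
Local Open Scope ring_scope.
Variable r : nat.
Implicit Types (b d : 'cV[int]_r) (f x y : nat -> int) (i j k p N : nat).
Implicit Types (pm : bool) (c : int) (S : pred nat).

(* Coordinates of b are indexed by nat from 1, and vanish outside [1, r]. *)
Definition coord b (k : nat) : int := \sum_(i < r | i.+1 == k) b i 0.

Lemma coordE b (i : 'I_r) : coord b i.+1 = b i 0.
Proof. by rewrite /coord (big_pred1 i) // => j; rewrite eqSS. Qed.

Lemma coord0 b : coord b 0 = 0.
Proof. by rewrite /coord big_pred0. Qed.

Lemma coord_out b k : (r < k)%N -> coord b k = 0.
Proof. by move=> rk; rewrite /coord big_pred0 // => i; case: i => i ? /=; lia. Qed.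

Lemma coord_linear (u : int) b d k : coord (u *: b + d) k = u * coord b k + coord d k.
Proof.
by rewrite mulr_sumr -big_split; apply: eq_bigr => i _; rewrite !mxE.
Qed.

Lemma coordD b d k : coord (b + d) k = coord b k + coord d k.
Proof. by rewrite -[b]scale1r coord_linear mul1r scale1r. Qed.

Lemma coordN b k : coord (- b) k = - coord b k.
Proof. by rewrite -sumrN; apply: eq_bigr => i _; rewrite mxE. Qed.

Lemma coord_inj b d : (forall k, (0 < k <= r)%N -> coord b k = coord d k) -> b = d.
Proof.
move=> e; apply/matrixP=> i l; rewrite (ord1 l) -!coordE; apply: e.
by case: i.
Qed.

Lemma coord_alpha (i : 'I_r) k : coord (alpha i) k = (k == i.+1)%:R.
Proof.
rewrite /coord; case: (eqVneq k i.+1) => [->|nk].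
  by rewrite -/(coord _ _) coordE mxE !eqxx.
by rewrite big1 // => j /eqP e; rewrite mxE -val_eqE -eqSS e (negbTE nk).
Qed.

Lemma coord_eta i j k : (0 < i)%N ->
  coord (eta r i j) k = ((i <= k <= j) && (k <= r))%N%:R.
Proof.
move=> i0; have [k0|k0] := posnP k; first by rewrite k0 coord0; lia.
have [rk|kr] := ltnP r k; first by rewrite coord_out //; lia.
have kr' : (k.-1 < r)%N by lia.
have := coordE (eta r i j) (Ordinal kr'); rewrite /= prednK // => ->.
by rewrite mxE /= prednK // andbT.
Qed.

(* The change of basis from simple roots to the standard basis e_1, ..., e_N:
   alpha_i = e_i - e_(i+1) for i < r, while alpha_r is e_r - e_(r+1) for
   (N, m) = (r+1, r+2), e_r for (r, r+1), 2 e_r for (r, r), and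
   e_(r-1) + e_r for (r, r-1), giving the types A, B, C and D. *)
Definition ecoord (N m : nat) f (k : nat) : int :=
  if (k <= N)%N then f k - f k.-1 + (if k == m then f r else 0) else 0.

Lemma ecoordN N m b k : ecoord N m (coord (- b)) k = - ecoord N m (coord b) k.
Proof. by rewrite /ecoord !coordN; do 2?[case: ifP => _]; ring. Qed.

(* Types B, C and D take pm = true, type A takes pm = false; c is 1 in type B
   and 2 in types C and D. *)
Definition eroots (N : nat) (pm : bool) (c : int) (S : pred nat) x : Prop :=
  (exists (i j : nat) (s t : bool), [/\ (0 < i <= N)%N, (0 < j <= N)%N, i != j &
     pm || (s == ~~ t)] /\
     forall k, x k = (-1) ^+ s * (k == i)%:R + (-1) ^+ t * (k == j)%:R) \/
  (exists (j : nat) (s : bool), ((0 < j <= N)%N /\ S j) /\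
     forall k, x k = (-1) ^+ s * c * (k == j)%:R).

Definition eposroots (N : nat) (pm : bool) (c : int) (S : pred nat) x : Prop :=
  [\/ exists i j, (0 < i < j)%N /\ (j <= N)%N /\
        forall k, x k = (k == i)%:R - (k == j)%:R,
      pm /\ exists i j, (0 < i < j)%N /\ (j <= N)%N /\
        forall k, x k = (k == i)%:R + (k == j)%:R |
      exists j, (0 < j <= N)%N /\ S j /\ forall k, x k = c * (k == j)%:R].

Lemma eq_eroots N pm c S S' x y : (forall k, (0 < k <= N)%N -> S k -> S' k) ->
  x =1 y -> eroots N pm c S x -> eroots N pm c S' y.
Proof.
move=> eS exy [[i [j [s [t [h xE]]]]]|[j [s [[jN Sj] xE]]]]; [left|right].
  by exists i, j, s, t; split=> // k; rewrite -exy.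
by exists j, s; split=> [|k]; [split=> //; exact: eS | rewrite -exy].
Qed.

Lemma eroots_pos N pm c S x :
  eroots N pm c S x <-> eposroots N pm c S x \/ eposroots N pm c S (fun k => - x k).
Proof.
split=> [[[i [j [s [t [[iN jN nij st] xE]]]]]|[j [s [[jN Sj] xE]]]]|].
- wlog ij : i j s t iN jN nij st xE / (i < j)%N.
    move=> wl; have [|ji] := ltnP i j; first exact: wl xE.
    apply: (wl j i t s); rewrite 1?eq_sym //; first by case: s t st {xE} => [] [].
      by move=> k; rewrite xE addrC.
    by rewrite ltn_neqAle eq_sym nij.
  case: s t st xE => [] [] /=; rewrite ?orbF ?orbT ?expr1 ?expr0 => pmP xE.
  + by right; apply: Or32; split=> //; exists i, j;
    split; [lia | split=> [|k]; [lia | rewrite xE; lia]].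
  + by right; apply: Or31; exists i, j;
    split; [lia | split=> [|k]; [lia | rewrite xE; lia]].
  + by left; apply: Or31; exists i, j;
    split; [lia | split=> [|k]; [lia | rewrite xE; lia]].
  + by left; apply: Or32; split=> //; exists i, j;
    split; [lia | split=> [|k]; [lia | rewrite xE; lia]].
- case: s xE => xE; [right|left]; apply: Or33; exists j; split=> //; split=> // k;
  by rewrite xE /= ?expr1 ?expr0; ring.
case=> [] [[i [j [ij [jN xE]]]]|[pmP [i [j [ij [jN xE]]]]]|[j [jN [Sj xE]]]].
- left; exists i, j, false, true; rewrite orbT; split; [split=> //; lia|].
  by move=> k; rewrite xE ?expr1 ?expr0; lia.
- left; exists i, j, false, false; rewrite pmP; split; [split=> //; lia|].
  by move=> k; rewrite xE ?expr1 ?expr0; lia.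
- by right; exists j, false; split=> // k; rewrite xE expr0 mul1r.
- left; exists i, j, true, false; rewrite orbT; split; [split=> //; lia|].
  by move=> k; rewrite -[LHS]opprK xE ?expr1 ?expr0; lia.
- left; exists i, j, true, true; rewrite pmP; split; [split=> //; lia|].
  by move=> k; rewrite -[LHS]opprK xE ?expr1 ?expr0; lia.
- by right; exists j, true; split=> // k; rewrite -[LHS]opprK xE expr1; ring.
Qed.

Lemma eroots_perm N pm c S (g : nat -> nat) x : involutive g ->
  (forall k, (0 < k <= N)%N -> (0 < g k <= N)%N) ->
  eroots N pm c S x <-> eroots N pm c (S \o g) (x \o g).
Proof.
move=> gK gN; have imp S' y : eroots N pm c S' y -> eroots N pm c (S' \o g) (y \o g).
  have gE k i : (g k == i) = (k == g i) by rewrite -{1}(gK i) (inv_eq gK) gK.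
  case=> [[i [j [s [t [[iN jN nij st] xE]]]]]|[j [s [[jN Sj] xE]]]]; [left|right].
    exists (g i), (g j), s, t; split; last by move=> k; rewrite /= xE !gE.
    by split; rewrite ?(inj_eq (inv_inj gK)) //; exact: gN.
  exists (g j), s; split; last by move=> k; rewrite /= xE gE.
  by rewrite /= gK; split=> //; exact: gN.
split=> [|/imp]; first exact: imp.
by apply: eq_eroots => k /=; rewrite gK.
Qed.

Definition flip p x (k : nat) : int := if k == p then - x k else x k.

(** Stated for [pm = true], where e_i + e_j accompanies e_i - e_j. A sign change moves no root c e_j
    to another index, so S stays the same. *)
Lemma eroots_flip N c S p x :
  eroots N true c S x <-> eroots N true c S (flip p x).
Proof.
have imp y : eroots N true c S y -> eroots N true c S (flip p y).
  have sE (i k : nat) (s : bool) (u : int) : (-1) ^+ (s (+) (i == p)) * u * (k == i)%:R =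
      (if k == p then - ((-1) ^+ s * u * (k == i)%:R) else (-1) ^+ s * u * (k == i)%:R).
    case: (eqVneq k i) => [->|_]; last by rewrite !mulr0 oppr0 if_same.
    by rewrite signr_addb; case: (i == p); rewrite ?expr1 ?expr0; ring.
  case=> [[i [j [s [t [[iN jN nij _] xE]]]]]|[j [s [h xE]]]]; [left|right].
    exists i, j, (s (+) (i == p)), (t (+) (j == p)); split=> // k.
    have := sE i k s 1; have := sE j k t 1; rewrite !mulr1 => -> ->.
    by rewrite /flip xE; case: ifP => // _; rewrite opprD.
  exists j, (s (+) (j == p)); split=> // k.
  by rewrite sE /flip xE.
split=> [|/imp]; first exact: imp.
by apply: eq_eroots => // k; rewrite /flip; case: (k == p); rewrite ?opprK.
Qed.

End Coordinates.

Ltac decide_nat :=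
  match goal with
  | |- context [@eq_op ?T ?a ?b] =>
    first [ have -> : (@eq_op T a b) = true by lia
          | have -> : (@eq_op T a b) = false by lia
          | case: (@eqVneq T a b) => ? ]
  | |- context [leq ?a ?b] =>
    first [ have -> : leq a b = true by lia
          | have -> : leq a b = false by lia
          | case: (leqP a b) => ? ]
  end.

(** * The listed positive roots translated into orthonormal coordinates *)

Section PositiveRoots.
Local Open Scope ring_scope.
Variable r : nat.
Implicit Types (b d : 'cV[int]_r).

(** Partial sums of the orthonormal coordinates recover the coefficients below m. As m >= r - 1, at
    most the last two remain, and there at worst twice a coefficient is recovered, which is enough
    over the integers. *)
Lemma ecoord_inj N m b d : (1 < r <= N)%N -> (r.-1 <= m)%N ->
  (forall k, ecoord r N m (coord b) k = ecoord r N m (coord d) k) -> b = d.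
Proof.
move=> rN rm e; have lt k : (k < m)%N -> (k <= r)%N -> coord b k = coord d k.
  elim: k => [|k IH] km kr; first by rewrite !coord0.
  move: (e k.+1) (IH ltac:(lia) ltac:(lia)).
  by rewrite /ecoord /=; do 2?case: ifP; lia.
apply: coord_inj => k kr; have [km|mk] := ltnP k m; first by apply: lt; lia.
move: (e r) (e r.-1) (lt r.-1) (lt r.-2).
have [->|nk] := eqVneq k r; last have -> : k = r.-1 by lia.
  by rewrite /ecoord; do 4?case: ifP; lia.
by rewrite /ecoord; do 4?case: ifP; lia.
Qed.

Ltac ecoord_eta :=
  rewrite /ecoord ?coordD !coord_eta; try lia; repeat decide_nat; by [].

Ltac root_witness :=
  match goal with xE : forall l, ecoord _ ?N ?m _ l = _ |- _ =>
    apply: (@ecoord_inj N m); [lia | lia | move=> ?; rewrite xE; ecoord_eta]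
  end.

Lemma pos_rootsA_ecoord c b : (1 < r)%N -> pos_rootsA r b <->
  eposroots r.+1 false c xpred0 (ecoord r r.+1 r.+2 (coord b)).
Proof.
move=> r1; split=> [[i [j [ij [jr ->]]]]|].
  apply: Or31; exists i, j.+1; split; [lia | split=> [|k]; [lia | ecoord_eta]].
case=> [[i [j [ij [jr xE]]]]|[//]|[j [_ []]] //].
exists i, j.-1; split; [lia | split; [lia | root_witness]].
Qed.

Lemma pos_rootsB_ecoord b : (1 < r)%N -> pos_rootsB r b <->
  eposroots r true 1 xpredT (ecoord r r r.+1 (coord b)).
Proof.
move=> r1; split=> [[[i [j [ij [jr ->]]]]|[i [j [ij [jr ->]]]]]|].
- have [jlt|jge] := ltnP j r.
    apply: Or31; exists i, j.+1; split; [lia | split=> [|k]; [lia | ecoord_eta]].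
  apply: Or33; exists i; split; [lia | split=> // k; ecoord_eta].
- apply: Or32; split=> //; exists i, j.
  split; [lia | split=> [|k]; [lia | ecoord_eta]].
case=> [[i [j [ij [jr xE]]]]|[_ [i [j [ij [jr xE]]]]]|[j [jr [_ xE]]]].
- left; exists i, j.-1; split; [lia | split; [lia | root_witness]].
- right; exists i, j; split; [lia | split; [lia | root_witness]].
- left; exists j, r; split; [lia | split; [lia | root_witness]].
Qed.

(** In type C coordinates eta_(i,j) is e_i - e_(j+1) for j < r, eta_(i,r) is e_i + e_r, and
    eta_(i,r) + eta_(j,r-1) is e_i + e_j. The index r joins Y because 2 e_r is the simple root
    alpha_r. *)
Lemma Psi_ecoord (Y : {pred nat}) b : (1 < r)%N ->
  {subset Y <= [pred j | 1 <= j < r]%N} -> Psi r Y b <->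
  eposroots r true 2 [pred j | (j \in Y) || (j == r)] (ecoord r r r (coord b)).
Proof.
move=> r1 Yr; split=> [[[[i [j [ij [jr ->]]]]|[i [j [ij [jr ->]]]]]|[j [jY ->]]]|].
- have [jlt|jge] := ltnP j r.
    apply: Or31; exists i, j.+1; split; [lia | split=> [|k]; [lia | ecoord_eta]].
  have [ilt|ige] := ltnP i r.
    apply: Or32; split=> //; exists i, r.
    split; [lia | split=> [|k]; [lia | ecoord_eta]].
  apply: Or33; exists r; split; [lia | split=> [/=|k]; [by rewrite eqxx orbT | ecoord_eta]].
- apply: Or32; split=> //; exists i, j.
  split; [lia | split=> [|k]; [lia | ecoord_eta]].
- have /= jr := Yr _ jY.
  apply: Or33; exists j; split; [move: jr; rewrite inE; lia|].
  split=> [/=|k]; [by rewrite jY | move: jr; rewrite inE => jr; ecoord_eta].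
case=> [[i [j [ij [jr xE]]]]|[_ [i [j [ij [jr xE]]]]]|[j [jr [/orP[jY|/eqP e] xE]]]].
- left; left; exists i, j.-1; split; [lia | split; [lia | root_witness]].
- have [jlt|jge] := ltnP j r.
    by left; right; exists i, j; split; [lia | split; [lia | root_witness]].
  left; left; exists i, r; split; [lia | split; [lia | root_witness]].
- have := Yr _ jY; rewrite inE => {}jr.
  right; exists j; split=> //; root_witness.
- left; left; exists r, r; split; [lia | split; [lia | root_witness]].
Qed.

(** Here eta_(i,j-1) is e_i - e_j, the family with alpha_r gives e_i + e_r, and eta_(i,r) +
    eta_(j,r-2) is e_i + e_j, which for i = j in Z is 2 e_j. *)
Lemma Phi_ecoord (Z : {pred nat}) b : (2 < r)%N ->
  {subset Z <= [pred j | 1 <= j < r]%N} -> Phi r Z b <->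
  eposroots r true 2 [pred j | j \in Z] (ecoord r r r.-1 (coord b)).
Proof.
move=> r2 Zr; split=> [[[[[i [j [ij [jr ->]]]]|[i [ir ->]]]|[i [j [ij [jr ->]]]]]|[j [jZ ->]]]|].
- apply: Or31; exists i, j; split; [lia | split=> [|k]; [lia | ecoord_eta]].
- apply: Or32; split=> //; exists i, r.
  split; [lia | split=> [|k]; [lia | ecoord_eta]].
- apply: Or32; split=> //; exists i, j.
  split; [lia | split=> [|k]; [lia | ecoord_eta]].
- have := Zr _ jZ; rewrite inE => jr.
  apply: Or33; exists j; split; [lia | split=> [//|k]; ecoord_eta].
case=> [[i [j [ij [jr xE]]]]|[_ [i [j [ij [jr xE]]]]]|[j [_ [jZ xE]]]].
- by left; left; left; exists i, j; split; [lia | split; [lia | root_witness]].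
- have [jlt|jge] := ltnP j r.
    by left; right; exists i, j; split; [lia | split; [lia | root_witness]].
  left; left; right; exists i; split; [lia | root_witness].
- have := Zr _ jZ; rewrite inE => jr.
  right; exists j; split=> //; root_witness.
Qed.

End PositiveRoots.

(** * Action of simple reflections on root sets in coordinates *)

Section Frames.
Local Open Scope ring_scope.
Implicit Types (r N m p k : nat) (f : nat -> int) (S : pred nat) (e : bool).

Definition frame r N pm c m S f := eroots N pm c S (ecoord r N m f).
Definition frameA r := frame r r.+1 false 1 r.+2 xpred0.
Definition frameB r := frame r r true 1 r.+1 xpredT.
Definition frameC r S := frame r r true 2 r S.
Definition frameD r S := frame r r true 2 r.-1 S.

(* The p-th rows of the Cartan matrices, as linear forms in the coordinates;
   e tells whether r - 1 belongs to S. *)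
Definition rowA p f : int := 2 * f p - f p.-1 - f p.+1.
Definition rowB r p f : int := rowA p f - (if p == r then f p.-1 else 0).
Definition rowC r e p f : int :=
  rowA p f - (if (p == r.-1) && e then f r else 0).
Definition rowD r e p f : int :=
  rowA p f - (if p == r.-2 then f r else 0) - (if p == r then f r.-2 else 0)
  + (if e then 0 else if p == r.-1 then f r else if p == r then f r.-1 else 0).

Definition reflect_along p (L : (nat -> int) -> int) f k : int :=
  f k - (if k == p then L f else 0).

Definition swap p k : nat := if k == p then p.+1 else if k == p.+1 then p else k.

Lemma swapK p : involutive (swap p).
Proof. by move=> k; rewrite /swap; repeat case: eqP; lia. Qed.

Lemma frame_swap r N pm c m m' S p L f : (0 < p < N)%N ->
  (forall k, ecoord r N m' (reflect_along p L f) k = ecoord r N m f (swap p k)) ->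
  frame r N pm c m S f <-> frame r N pm c m' (S \o swap p) (reflect_along p L f).
Proof.
move=> pN e; rewrite /frame (eroots_perm _ _ _ _ (@swapK p)); last first.
  by move=> k kN; rewrite /swap; do 2?case: eqP; lia.
by split; apply: eq_eroots => // k.
Qed.

Lemma frame_flip r N c m S p p' L f :
  (forall k, ecoord r N m (reflect_along p' L f) k = flip p (ecoord r N m f) k) ->
  frame r N true c m S f <-> frame r N true c m S (reflect_along p' L f).
Proof.
move=> e; rewrite /frame (eroots_flip _ _ _ p).
by split; apply: eq_eroots => // k.
Qed.

Ltac reflect_tac k p :=
  rewrite /ecoord /reflect_along /swap /flip /rowB /rowC /rowD /rowA;
  case: (eqVneq k p) => [->|?]; [|case: (eqVneq k p.+1) => [->|?]];
  rewrite /=; repeat (decide_nat; rewrite /=); repeat (case: ifP => ? /=); lia.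

Lemma reflect_frameA r p f : (0 < p <= r)%N -> f r.+1 = 0 ->
  frameA r f <-> frameA r (reflect_along p (rowA p) f).
Proof. by move=> pr fr; apply: frame_swap => // k; reflect_tac k p. Qed.

Lemma reflect_frameB r p f : (1 < r)%N -> (0 < p <= r)%N -> f r.+1 = 0 ->
  frameB r f <-> frameB r (reflect_along p (rowB r p) f).
Proof.
move=> r1 pr fr; case: (ltnP p r) => pltr.
  by apply: frame_swap => [|k]; [lia | reflect_tac k p].
have -> : p = r by lia.
by apply: (@frame_flip _ _ _ _ _ r) => k; reflect_tac k r.
Qed.

Lemma reflect_frameC r S e p f : (0 < p < r.-1)%N ->
  frameC r S f <-> frameC r (S \o swap p) (reflect_along p (rowC r e p) f).
Proof. by move=> pr; apply: frame_swap => [|k]; [lia | reflect_tac k p]. Qed.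

Lemma reflect_frameC_last r S e f : (1 < r)%N -> f r.+1 = 0 ->
  frameC r S f <-> frameC r S (reflect_along r (rowC r e r) f).
Proof.
by move=> r1 fr; apply: (@frame_flip _ _ _ _ _ r) => k; reflect_tac k r.
Qed.

(** With entry -2 at (r-1, r), the root alpha_r + 2 alpha_(r-1) = 2 e_(r-1) becomes the last simple
    root and the basis stays of type C, as happens when r - 1 is in S. *)
Lemma reflect_frameC_full r S f : (1 < r)%N -> frameC r S f <->
  frameC r (S \o swap r.-1) (reflect_along r.-1 (rowC r true r.-1) f).
Proof.
case: r => [|[|q]] //= _.
by apply: frame_swap => [|k]; [lia | reflect_tac k (q.+1)].
Qed.

(** When r - 1 is outside S, 2 e_(r-1) is no root and the string through alpha_r stops at alpha_r +
    alpha_(r-1) = e_(r-1) + e_r, the last simple root of a type D basis. Hence the entry -1 at (r-1,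
    r). *)
Lemma reflect_frameCD r S f : (1 < r)%N -> frameC r S f <->
  frameD r (S \o swap r.-1) (reflect_along r.-1 (rowC r false r.-1) f).
Proof.
case: r => [|[|q]] //= _.
by apply: frame_swap => [|k]; [lia | reflect_tac k (q.+1)].
Qed.

Lemma reflect_frameD r S e p f : (0 < p < r.-1)%N ->
  frameD r S f <-> frameD r (S \o swap p) (reflect_along p (rowD r e p) f).
Proof.
case: r => [|[|q]] pr; [lia | lia | apply: frame_swap => [|k]; first by lia].
(* Here q is r - 2, the branch node of the diagram, whose row also contains [f r]. *)
have [->|nq] := eqVneq p q; [reflect_tac k q|reflect_tac k p].
Qed.

Lemma reflect_frameD_pen r S f : (2 < r)%N -> frameD r S f <->
  frameD r (S \o swap r.-1) (reflect_along r.-1 (rowD r false r.-1) f).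
Proof.
case: r => [|[|q]] //= _.
by apply: frame_swap => [|k]; [lia | reflect_tac k (q.+1)].
Qed.

(** The inverse move: for r - 1 in S the string through alpha_r ends at alpha_r + alpha_(r-1) = 2
    e_(r-1), which after the swap is the last simple root of a type C basis. *)
Lemma reflect_frameDC r S f : (2 < r)%N -> frameD r S f <->
  frameC r (S \o swap r.-1) (reflect_along r.-1 (rowD r true r.-1) f).
Proof.
case: r => [|[|q]] //= _.
by apply: frame_swap => [|k]; [lia | reflect_tac k (q.+1)].
Qed.

(** Reflection in e_(r-1) + e_r swaps these two coordinates and negates both; only the swap acts on
    S. *)
Lemma reflect_frameD_last r S f : (2 < r)%N -> f r.+1 = 0 -> frameD r S f <->
  frameD r (S \o swap r.-1) (reflect_along r (rowD r false r) f).
Proof.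
case: r => [|[|q]] //= q0 fr; rewrite /frameD /frame.
rewrite (eroots_perm _ _ _ _ (@swapK q.+1)); last first.
  by move=> k kN; rewrite /swap; do 2?case: eqP; lia.
rewrite (eroots_flip _ _ _ q.+1) (eroots_flip _ _ _ q.+2).
have e k : flip q.+2 (flip q.+1 (ecoord q.+2 q.+2 q.+1 f \o swap q.+1)) k =
    ecoord q.+2 q.+2 q.+1 (reflect_along q.+2 (rowD q.+2 false q.+2) f) k.
  have sE : swap q.+1 k =
      if k == q.+1 then q.+2 else if k == q.+2 then q.+1 else k by [].
  rewrite /ecoord /reflect_along /flip /rowD /rowA /= sE.
  case: (eqVneq k q.+1) => [->|?]; [|case: (eqVneq k q.+2) => [->|?]];
    rewrite /=; repeat (decide_nat; rewrite /=); repeat (case: ifP => ? /=); lia.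
by split; apply: eq_eroots => // k; rewrite e.
Qed.

End Frames.

(** * Sign coherence and simple roots of the candidate root sets *)

Section FrameLemmas.
Local Open Scope classical_set_scope.
Local Open Scope ring_scope.
Implicit Types (r p q k : nat) (f : nat -> int) (S : pred nat) (e : bool).

Definition unitf q k : int := (k == q)%:R.

Lemma coord_alphaE r (i : 'I_r) : coord (alpha i) = unitf i.+1.
Proof. by apply: funext => k; rewrite coord_alpha. Qed.

Definition admissible r (F : (nat -> int) -> Prop) : Prop :=
  sign_coherent [set b : 'cV[int]_r | F (coord b)] /\
  forall q, (0 < q <= r)%N -> F (unitf q).

(** The positive roots determine all roots, since the set is closed under negation and every root is
    positive or negative. *)
Lemma roots_frame r N pm c S m (P : set 'cV[int]_r) (D : set 'cV[int]_r) :
  (forall b, P b <-> eposroots N pm c S (ecoord r N m (coord b))) ->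
  D `&` @nonneg_vec r = P -> sign_coherent D -> (forall b, D b -> D (- b)) ->
  forall b, D b <-> frame r N pm c m S (coord b).
Proof.
move=> PE DP cohD DN b; rewrite /frame eroots_pos -PE.
have -> : (fun k => - ecoord r N m (coord b) k) = ecoord r N m (coord (- b)).
  by apply: funext => k; rewrite ecoordN.
rewrite -PE -DP; split=> [Db|[[]//|[/DN]]]; last by rewrite opprK.
by case: (cohD b Db) => h; [left | right]; split=> //; exact: DN.
Qed.

Lemma frame_admissible r N pm c S m (P : set 'cV[int]_r) :
  (forall b, P b <-> eposroots N pm c S (ecoord r N m (coord b))) ->
  P `<=` @nonneg_vec r -> (forall i, (0 < i <= r)%N -> P (eta r i i)) ->
  admissible r (frame r N pm c m S).
Proof.
move=> PE P0 Ps; split=> [b /eroots_pos|q qr].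
  have -> : (fun k => - ecoord r N m (coord b) k) = ecoord r N m (coord (- b)).
    by apply: funext => k; rewrite ecoordN.
  by rewrite -!PE => -[] /P0; [left | right].
apply/eroots_pos; left; have /PE := Ps q qr.
rewrite (_ : coord _ = unitf q) //; apply: funext => k.
by rewrite coord_eta /unitf; lia.
Qed.

Lemma eta_ge0 r i j (k : 'I_r) l : 0 <= eta r i j k l.
Proof. by rewrite mxE. Qed.

Lemma eta2_ge0 r i j i' j' : nonneg_vec (eta r i j + eta r i' j').
Proof. by move=> k; rewrite mxE addr_ge0 ?eta_ge0. Qed.

Lemma frameA_admissible r : (1 < r)%N -> admissible r (frameA r).
Proof.
move=> r1; apply: (frame_admissible (P := pos_rootsA r)) => [b|b|i ir].
- exact: pos_rootsA_ecoord.
- by move=> [i [j [_ [_ ->]]]] k; exact: eta_ge0.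
- by exists i, i; split; [lia | split; [lia|]].
Qed.

Lemma frameB_admissible r : (1 < r)%N -> admissible r (frameB r).
Proof.
move=> r1; apply: (frame_admissible (P := pos_rootsB r)) => [b|b|i ir].
- exact: pos_rootsB_ecoord.
- move=> [[i [j [_ [_ ->]]]] k|[i [j [_ [_ ->]]]]]; first exact: eta_ge0.
  exact: eta2_ge0.
- by left; exists i, i; split; [lia | split; [lia|]].
Qed.

Lemma eq_frame r N pm c m S S' f : (forall k, (0 < k <= N)%N -> S k = S' k) ->
  frame r N pm c m S f <-> frame r N pm c m S' f.
Proof. by move=> eS; split; apply: eq_eroots => // k kN; rewrite eS. Qed.

Lemma eq_admissible r (F F' : (nat -> int) -> Prop) : (forall f, F f <-> F' f) ->
  admissible r F -> admissible r F'.
Proof.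
by move=> e [h1 h2]; split=> [b /e|q qr]; [exact: h1 | apply/e; exact: h2].
Qed.

(** The condition [S r] puts alpha_r = 2 e_r among the roots. Only the values of S on [1, r] matter,
    so S can be replaced by a set of the form treated in [Psi_ecoord]. *)
Lemma frameC_admissible r S : (1 < r)%N -> S r -> admissible r (frameC r S).
Proof.
move=> r1 Sr; pose Y : {pred nat} := [pred j | (0 < j < r)%N && S j].
have YP : {subset Y <= [pred j | 1 <= j < r]%N} by move=> j; rewrite !inE => /andP[].
apply: (eq_admissible (F := frameC r [pred j | (j \in Y) || (j == r)])).
  move=> f; apply: eq_frame => k kr; rewrite /= inE.
  have [->|nk] := eqVneq k r; first by rewrite orbT Sr.
  by rewrite orbF; have -> : (0 < k < r)%N by lia.
apply: (frame_admissible (P := Psi r Y)) => [b|b|i ir].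
- exact: Psi_ecoord.
- move=> [[[i [j [_ [_ ->]]]] k|[i [j [_ [_ ->]]]]]|[j [_ ->]]].
  + exact: eta_ge0.
  + exact: eta2_ge0.
  + exact: eta2_ge0.
- by left; left; exists i, i; split; [lia | split; [lia|]].
Qed.

(** Here r must be outside S, since 2 e_r = alpha_r - alpha_(r-1) has mixed signs. *)
Lemma frameD_admissible r S : (2 < r)%N -> ~~ S r -> admissible r (frameD r S).
Proof.
move=> r2 Sr; pose Z : {pred nat} := [pred j | (0 < j < r)%N && S j].
have ZP : {subset Z <= [pred j | 1 <= j < r]%N} by move=> j; rewrite !inE => /andP[].
apply: (eq_admissible (F := frameD r [pred j | j \in Z])).
  move=> f; apply: eq_frame => k kr; rewrite /= inE.
  have [->|nk] := eqVneq k r; first by rewrite ltnn andbF (negbTE Sr).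
  by have -> : (0 < k < r)%N by lia.
apply: (frame_admissible (P := Phi r Z)) => [b|b|i ir].
- by apply: Phi_ecoord.
- move=> [[[[i [j [_ [_ ->]]]] k|[i [_ ->]]]|[i [j [_ [_ ->]]]]]|[j [_ ->]]].
  + exact: eta_ge0.
  + exact: eta2_ge0.
  + exact: eta2_ge0.
  + exact: eta2_ge0.
- have [ir'|ri] := ltnP i r.
    by left; left; left; exists i, i.+1; split; [lia | split; [lia|]].
  (* The root alpha_r is reached with index r - 1, where [eta r r.-1 r.-2] is the empty sum. *)
  left; left; right; exists r.-1; split; [lia|].
  have -> : i = r by lia.
  by apply: coord_inj => k kr; rewrite coordD !coord_eta; lia.
Qed.

Definition is_row p (L : (nat -> int) -> int) : Prop :=
  (forall (u : int) f g, L (fun k => u * f k + g k) = u * L f + L g) /\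
  L (unitf p) = 2.

Ltac row_tac := rewrite /rowB /rowC /rowD /rowA;
  split=> [u f g|] /=; rewrite ?/unitf; repeat (case: ifP => ?); (ring || lia).

Lemma rowA_is_row p : (0 < p)%N -> is_row p (rowA p).
Proof. by move=> p0; row_tac. Qed.

Lemma rowB_is_row r p : (0 < p)%N -> is_row p (rowB r p).
Proof. by move=> p0; row_tac. Qed.

Lemma rowC_is_row r e p : (1 < r)%N -> (0 < p)%N -> is_row p (rowC r e p).
Proof. by move=> r1 p0; row_tac. Qed.

Lemma rowD_is_row r e p : (2 < r)%N -> (0 < p)%N -> is_row p (rowD r e p).
Proof. by move=> r2 p0; row_tac. Qed.

(* Negating e_r exchanges the last two simple roots. *)
Lemma frameD_swap r S f : (2 < r)%N ->
  frameD r S f <-> frameD r S (f \o swap r.-1).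
Proof.
case: r => [|[|q]] //= q0; rewrite /frameD /frame.
rewrite (eroots_flip _ _ _ q.+2).
have e k : flip q.+2 (ecoord q.+2 q.+2 q.+1 f) k =
    ecoord q.+2 q.+2 q.+1 (f \o swap q.+1) k.
  rewrite /flip /ecoord /swap.
  case: (eqVneq k q.+1) => [->|?]; [|case: (eqVneq k q.+2) => [->|?]];
    rewrite /=; repeat (decide_nat; rewrite /=); repeat (case: ifP => ? /=); lia.
by split; apply: eq_eroots => // k; rewrite e.
Qed.

End FrameLemmas.

(** * Root sets and Cartan matrices at a point and across its walls *)

Lemma pred_index_lt r p : 0 < p <= r -> p.-1 < r.
Proof. lia. Qed.

Definition index1 r p (pr : 0 < p <= r) : 'I_r := Ordinal (pred_index_lt pr).

Lemma index1E r p (pr : 0 < p <= r) : (index1 pr).+1 = p.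
Proof. by rewrite /=; lia. Qed.

Section FramedPoints.
Local Open Scope ring_scope.
Variables (r : nat) (C : semi_cartan_graph r).
Hypothesis r3 : (3 < r)%N.
Hypothesis cohC : forall X : point C, sign_coherent (real_roots X).
Implicit Types (X : point C) (i j : 'I_r) (S : pred nat).

Definition roots_at X (F : (nat -> int) -> Prop) : Prop :=
  forall b, real_roots X b <-> F (coord b).

Lemma reflect_coord p i (L : (nat -> int) -> int) (b : 'cV[int]_r) : i.+1 = p ->
  coord (b - L (coord b) *: alpha i) = reflect_along p L (coord b).
Proof.
move=> ip; apply: funext => k; rewrite addrC -scaleNr coord_linear coord_alpha ip.
by rewrite /reflect_along; case: eqP => _; rewrite ?mulr0 ?mulr1; ring.
Qed.

Lemma frame_step X i p L (F F' : (nat -> int) -> Prop) : i.+1 = p ->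
  is_row p L -> admissible r F' -> roots_at X F ->
  (forall f, f 0 = 0 -> f r.+1 = 0 -> F f <-> F' (reflect_along p L f)) ->
  (forall j, cartan X i j = L (unitf j.+1)) /\ roots_at (refl i X) F'.
Proof.
move=> ip [linL Lp] [cohF simF] XF FF'.
have [||b|j|b|rowE XF'] := @cartan_row_unique _ _ cohC X i (fun b => L (coord b))
    [set b : 'cV[int]_r | F' (coord b)]%classic.
- move=> k b c; rewrite -linL; congr L; apply: funext => q.
  exact: coord_linear.
- by rewrite coord_alphaE ip.
- exact: cohF.
- by rewrite /= coord_alphaE; apply: simF; rewrite ltn_ord.
- by rewrite XF FF' ?coord0 ?coord_out // /= (reflect_coord _ _ ip).
by split=> // j; rewrite rowE coord_alphaE.
Qed.

(** The points with root set F form a nonempty set stable under all r_i, hence all points by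
    connectedness; crossing a wall at any of them then yields the corresponding row. *)
Lemma standard_frame X0 (F : (nat -> int) -> Prop)
    (row : nat -> (nat -> int) -> int) :
  graph_connected C -> admissible r F ->
  (forall p, (0 < p <= r)%N -> is_row p (row p)) ->
  (forall p f, (0 < p <= r)%N -> f 0 = 0 -> f r.+1 = 0 ->
     F f <-> F (reflect_along p (row p) f)) ->
  roots_at X0 F -> forall X i j, cartan X i j = row i.+1 (unitf j.+1).
Proof.
move=> conn admF rowP FF X0F.
have step X i : roots_at X F ->
    (forall j, cartan X i j = row i.+1 (unitf j.+1)) /\ roots_at (refl i X) F.
  move=> XF; have ir : (0 < i.+1 <= r)%N := ltn_ord i.
  by apply: (frame_step erefl (rowP _ ir)) XF _ => // f; exact: FF.
have allF : [set X | roots_at X F]%classic = setT.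
  by apply: conn => [|i X XF]; [exists X0 | have [] := step X i XF].
move=> X i; suff /(step X i)[] : roots_at X F by [].
by have : setT X by []; rewrite -allF.
Qed.

Lemma swap_pen : swap r.-1 r = r.-1.
Proof. by rewrite /swap ifF ?ifT //; lia. Qed.

Section FrameCSteps.
Variables (X : point C) (S : pred nat).
Hypotheses (Sr : S r) (XS : roots_at X (frameC r S)).

Lemma frameC_low i : (i.+1 < r.-1)%N ->
  (forall j, cartan X i j = rowC r (S r.-1) i.+1 (unitf j.+1)) /\
  roots_at (refl i X) (frameC r (S \o swap i.+1)).
Proof.
move=> ir; apply: (frame_step erefl) XS _; first by apply: rowC_is_row; lia.
  apply: frameC_admissible; first by lia.
  by rewrite /= /swap !ifF //; lia.
by move=> f _ _; apply: reflect_frameC; lia.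
Qed.

Lemma frameC_last i : i.+1 = r ->
  (forall j, cartan X i j = rowC r (S r.-1) i.+1 (unitf j.+1)) /\
  roots_at (refl i X) (frameC r S).
Proof.
move=> ir; apply: (frame_step erefl) XS _; first by apply: rowC_is_row; lia.
  by apply: frameC_admissible => //; lia.
by move=> f _ fr; rewrite ir; apply: reflect_frameC_last => //; lia.
Qed.

Lemma frameC_full i : i.+1 = r.-1 -> S r.-1 ->
  (forall j, cartan X i j = rowC r (S r.-1) i.+1 (unitf j.+1)) /\
  roots_at (refl i X) (frameC r (S \o swap r.-1)).
Proof.
move=> ir Sp; rewrite Sp; apply: (frame_step erefl) XS _; first by apply: rowC_is_row; lia.
  by apply: frameC_admissible; rewrite /= ?swap_pen //; lia.
by move=> f _ fr; rewrite ir; apply: reflect_frameC_full => //; lia.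
Qed.

Lemma frameCD i : i.+1 = r.-1 -> ~~ S r.-1 ->
  (forall j, cartan X i j = rowC r (S r.-1) i.+1 (unitf j.+1)) /\
  roots_at (refl i X) (frameD r (S \o swap r.-1)).
Proof.
move=> ir nS; rewrite (negbTE nS).
apply: (frame_step erefl) XS _; first by apply: rowC_is_row; lia.
  by apply: frameD_admissible; rewrite /= ?swap_pen //; lia.
by move=> f _ fr; rewrite ir; apply: reflect_frameCD => //; lia.
Qed.

Lemma cartan_frameC i j : cartan X i j = rowC r (S r.-1) i.+1 (unitf j.+1).
Proof.
have [ir|ri] := ltnP i.+1 r.-1; first by case: (frameC_low ir) => + _; apply.
have [ir|ni] := eqVneq i.+1 r; first by case: (frameC_last ir) => + _; apply.
have ir : i.+1 = r.-1 by have := ltn_ord i; lia.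
have [Sp|nSp] := boolP (S r.-1).
  by case: (frameC_full ir Sp) => + _; rewrite Sp; apply.
by case: (frameCD ir nSp) => + _; rewrite (negbTE nSp); apply.
Qed.

End FrameCSteps.

Section FrameDSteps.
Variables (X : point C) (S : pred nat).
Hypotheses (Sr : ~~ S r) (XS : roots_at X (frameD r S)).

Lemma frameD_low i : (i.+1 < r.-1)%N ->
  (forall j, cartan X i j = rowD r (S r.-1) i.+1 (unitf j.+1)) /\
  roots_at (refl i X) (frameD r (S \o swap i.+1)).
Proof.
move=> ir; apply: (frame_step erefl) XS _; first by apply: rowD_is_row; lia.
  apply: frameD_admissible; first by lia.
  by rewrite /= /swap !ifF //; lia.
by move=> f _ _; apply: reflect_frameD; lia.
Qed.

Lemma frameDC i : i.+1 = r.-1 -> S r.-1 ->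
  (forall j, cartan X i j = rowD r (S r.-1) i.+1 (unitf j.+1)) /\
  roots_at (refl i X) (frameC r (S \o swap r.-1)).
Proof.
move=> ir Sp; rewrite Sp; apply: (frame_step erefl) XS _; first by apply: rowD_is_row; lia.
  by apply: frameC_admissible; rewrite /= ?swap_pen //; lia.
by move=> f _ fr; rewrite ir; apply: reflect_frameDC => //; lia.
Qed.

Lemma frameD_pen i : i.+1 = r.-1 -> ~~ S r.-1 ->
  (forall j, cartan X i j = rowD r (S r.-1) i.+1 (unitf j.+1)) /\
  roots_at (refl i X) (frameD r (S \o swap r.-1)).
Proof.
move=> ir nS; rewrite (negbTE nS).
apply: (frame_step erefl) XS _; first by apply: rowD_is_row; lia.
  by apply: frameD_admissible; rewrite /= ?swap_pen //; lia.
by move=> f _ fr; rewrite ir; apply: reflect_frameD_pen => //; lia.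
Qed.

Lemma frameD_last i : i.+1 = r -> ~~ S r.-1 ->
  (forall j, cartan X i j = rowD r (S r.-1) i.+1 (unitf j.+1)) /\
  roots_at (refl i X) (frameD r (S \o swap r.-1)).
Proof.
move=> ir nS; rewrite (negbTE nS).
apply: (frame_step erefl) XS _; first by apply: rowD_is_row; lia.
  by apply: frameD_admissible; rewrite /= ?swap_pen //; lia.
by move=> f _ fr; rewrite ir; apply: reflect_frameD_last => //; lia.
Qed.

(** By [frameD_swap] the root strings are symmetric under exchanging the labels r - 1 and r. *)
Lemma cartan_frameD_swap (i1 i2 : 'I_r) : i1.+1 = r.-1 -> i2.+1 = r ->
  forall i j, cartan X (tperm i1 i2 i) (tperm i1 i2 j) = cartan X i j.
Proof.
move=> e1 e2; apply: cartan_symm => // [i|i j k]; first exact: tpermK.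
have tE l : (tperm i1 i2 l).+1 = swap r.-1 l.+1.
  case: tpermP => [->|->|n1 n2]; rewrite /swap.
  - by rewrite e1 eqxx; lia.
  - by rewrite e2 ifF ?ifT //; lia.
  rewrite !ifF //; apply/eqP => e; [case: n2 | case: n1]; apply: val_inj => /=; lia.
rewrite !XS frameD_swap; last by lia.
suff -> : coord (alpha (tperm i1 i2 j) + k *: alpha (tperm i1 i2 i)) =
  coord (alpha j + k *: alpha i) \o swap r.-1 by [].
apply: funext => q; rewrite /= ![alpha _ + _]addrC !coord_linear !coord_alpha !tE.
by rewrite !(inv_eq (@swapK r.-1)).
Qed.

Lemma cartan_frameD i j : cartan X i j = rowD r (S r.-1) i.+1 (unitf j.+1).
Proof.
have [ir|ri] := ltnP i.+1 r.-1; first by case: (frameD_low ir) => + _; apply.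
have [ir|ni] := eqVneq i.+1 r; last first.
  have ir : i.+1 = r.-1 by have := ltn_ord i; lia.
  have [Sp|nSp] := boolP (S r.-1).
    by case: (frameDC ir Sp) => + _; rewrite Sp; apply.
  by case: (frameD_pen ir nSp) => + _; rewrite (negbTE nSp); apply.
have [Sp|nSp] := boolP (S r.-1); last first.
  by case: (frameD_last ir nSp) => + _; rewrite (negbTE nSp); apply.
(* With r - 1 in S, crossing the last wall would give a type C basis with the labels r - 1 and r
   exchanged; row r is instead obtained from row r - 1 by the symmetry. *)
have pr : (0 < r.-1 <= r)%N by lia.
have e1 := index1E pr; set i1 := index1 pr in e1.
rewrite -(cartan_frameD_swap e1 ir) tpermR.
case: (frameDC e1 Sp) => -> _; rewrite Sp ir e1.
case: tpermP => [->|->|n1 n2]; rewrite ?e1 ?ir.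
- by rewrite /rowD /rowA /unitf; repeat case: ifP => ?; lia.
- by rewrite /rowD /rowA /unitf; repeat case: ifP => ?; lia.
have {n1} : j.+1 != r.-1 by apply/eqP => e; case: n1; apply: val_inj => /=; lia.
have {n2} : j.+1 != r by apply/eqP => e; case: n2; apply: val_inj => /=; lia.
by move: (ltn_ord j); rewrite /rowD /rowA /unitf; repeat case: ifP => ?; lia.
Qed.

End FrameDSteps.

End FramedPoints.

(** * The explicit Cartan matrices row by row *)

Section CartanMatrices.
Local Open Scope ring_scope.
Variable r : nat.
Hypothesis r3 : (3 < r)%N.

Ltac entry_tac i j :=
  have := ltn_ord i; have := ltn_ord j => ? ?;
  rewrite !mxE ?xpair_eqE ?inE ?xpair_eqE /adjacent /rowB /rowC /rowD /rowA /unitf;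
  repeat decide_nat; by [].

Lemma cartanA_row (i j : 'I_r) : cartanA r i j = rowA i.+1 (unitf j.+1).
Proof. entry_tac i j. Qed.

Lemma cartanB_row (i j : 'I_r) : cartanB r i j = rowB r i.+1 (unitf j.+1).
Proof. entry_tac i j. Qed.

Lemma cartanC_row (i j : 'I_r) : cartanC r i j = rowC r true i.+1 (unitf j.+1).
Proof. entry_tac i j. Qed.

Lemma cartanD_row (i j : 'I_r) : cartanD r i j = rowD r false i.+1 (unitf j.+1).
Proof. entry_tac i j. Qed.

(** The ordinal [i] stands for index i + 1, which counted backwards is r - i. With r - 1 in the set,
    the fork ends r - 1 and r are joined and form the triangle with r - 2. *)
Lemma triangle_row (i j : 'I_r) :
  triangle_mx r i j = rowD r true (r - i) (unitf (r - j)).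
Proof. entry_tac i j. Qed.

(** Backwards the entry (2, 1) is (r-1, r), the only one that depends on the membership of r - 1. *)
Lemma chain_row (e : bool) (i j : 'I_r) :
  chain_mx r (if e then 2 else 1) i j = rowC r e (r - i) (unitf (r - j)).
Proof. case: e; entry_tac i j. Qed.

End CartanMatrices.


(** * Reaching a point with a good D'_r neighborhood *)

Section GoodPoint.
Local Open Scope ring_scope.
Variables (r : nat) (C : semi_cartan_graph r).
Hypothesis r4 : (4 < r)%N.
Hypothesis cohC : forall X : point C, sign_coherent (real_roots X).
Implicit Types (X : point C) (i j : 'I_r) (S : pred nat).

Let r3 : (3 < r)%N := ltnW r4.

(** Backwards, wall 2 is r - 1 and leads to type D with r - 1 in the new set, hence to the triangle;
    wall 3 is r - 2 and stays in type C. The other walls leave the membership of r - 1, and so the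
    Cartan matrix, unchanged. *)
Lemma frameC_good X S : S r -> ~~ S r.-1 -> roots_at X (frameC r S) ->
  good_D'_neighborhood X.
Proof.
move=> Sr nS XS; exists (perm (@rev_ord_inj r)).
have p1 : (0 < 1 <= r)%N by lia. have p2 : (0 < 2 <= r)%N by lia.
have p3 : (0 < 3 <= r)%N by lia. have p4 : (0 < 4 <= r)%N by lia.
exists (index1 p1), (index1 p2), (index1 p3), (index1 p4).
split; first by split.
have revE i : (perm (@rev_ord_inj r) i).+1 = (r - i)%N.
  by rewrite permE /=; have := ltn_ord i; lia.
pose j1 := perm (@rev_ord_inj r) (index1 p1).
pose j2 := perm (@rev_ord_inj r) (index1 p2).
pose j3 := perm (@rev_ord_inj r) (index1 p3).
pose j4 := perm (@rev_ord_inj r) (index1 p4).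
have e2 : j2.+1 = r.-1 by rewrite revE /=; lia.
have e3 : j3.+1 = r.-2 by rewrite revE /=; lia.
have X2 : roots_at (refl j2 X) (frameD r (S \o swap r.-1)).
  by case: (frameCD r3 cohC Sr XS e2 nS).
have X3 : roots_at (refl j3 X) (frameC r (S \o swap r.-2)).
  by rewrite -e3; apply: (frameC_low r3 cohC Sr XS _).2; lia.
have S2r : ~~ (S \o swap r.-1) r by rewrite /= swap_pen //.
have S2p : (S \o swap r.-1) r.-1.
  by rewrite /= /swap eqxx prednK //; lia.
have S3r : (S \o swap r.-2) r by rewrite /= /swap !ifF //; lia.
(* Crossing the wall r - 2 gives r - 1 the membership of r - 2, which decides between the two
   chains. *)
exists (if S r.-2 then 2 else 1); split.
- by case: ifP; [right | left].
- move=> i n2 n3; apply/matrixP => k l; rewrite /= !mxE.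
  set i' := perm (@rev_ord_inj r) i.
  have {n2} n2 : i'.+1 != r.-1.
    rewrite revE; apply/eqP => e; case/eqP: n2; apply: val_inj => /=.
    by have := ltn_ord i; lia.
  have {n3} n3 : i'.+1 != r.-2.
    rewrite revE; apply/eqP => e; case/eqP: n3; apply: val_inj => /=.
    by have := ltn_ord i; lia.
  have ltr := ltn_ord i'; rewrite (cartan_frameC r3 cohC Sr XS).
  have [ir|ir] := eqVneq i'.+1 r.
    by rewrite (cartan_frameC r3 cohC Sr (frameC_last r3 cohC Sr XS ir).2).
  have ilt : (i'.+1 < r.-2)%N by lia.
  have ilt' : (i'.+1 < r.-1)%N by lia.
  rewrite (cartan_frameC r3 cohC _ (frameC_low r3 cohC Sr XS ilt').2).
    by rewrite /= [swap _ r.-1]/swap !ifF //; lia.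
  by rewrite /= [swap _ r]/swap !ifF //; lia.
- apply/matrixP => k l; rewrite triangle_row // /= !mxE.
  by rewrite (cartan_frameD r3 cohC S2r X2) S2p !revE.
- apply/matrixP => k l; rewrite chain_row // /= !mxE.
  rewrite (cartan_frameC r3 cohC S3r X3) !revE.
  by rewrite /= [swap _ r.-1]/swap ifF ?ifT //; lia.
rewrite /= !mxE.
have X23 : roots_at (refl j3 (refl j2 X)) (frameD r ((S \o swap r.-1) \o swap r.-2)).
  by rewrite -e3; apply: (frameD_low r3 cohC S2r X2 _).2; lia.
rewrite (cartan_frameD r3 cohC _ X23) ?revE /=; last first.
  by rewrite {2}/swap !ifF //; lia.
(* The nodes r and r - 3 are not joined at a type D point, whatever the membership of r - 1. *)
by move: (S _) => e; rewrite /rowD /rowA /unitf; repeat decide_nat; case: e.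
Qed.

(** Crossing wall j moves the missing index from j to j + 1; induction on r - j brings it to r -
    1. *)
Lemma frameC_walk S (j : nat) X : (0 < j < r)%N -> ~~ S j -> S r ->
  roots_at X (frameC r S) -> exists Y : point C, good_D'_neighborhood Y.
Proof.
elim: {j}(r - j)%N {-2}j (erefl (r - j)%N) S X => [|n IH] j rj S X jr nSj Sr XS; first by lia.
have [ej|nj] := eqVneq j r.-1.
  by exists X; apply: frameC_good XS => //; rewrite -ej.
have pj : (0 < j <= r)%N by lia.
have [] := frameC_low r3 cohC Sr XS (i := index1 pj); first by rewrite index1E; lia.
rewrite index1E => _ XS'; apply: (IH j.+1 _ _ _ _ _ _ XS'); try lia.
  by rewrite /= /swap ifF ?eqxx //; lia.
by rewrite /= /swap !ifF //; lia.
Qed.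

(** An index of S is moved up to r - 1 in the same way. One more crossing exchanges it with r,
    giving type C with r in the set and r - 1 outside. *)
Lemma frameD_walk S (j : nat) X : (0 < j < r)%N -> S j -> ~~ S r ->
  roots_at X (frameD r S) -> exists Y : point C, good_D'_neighborhood Y.
Proof.
elim: {j}(r - j)%N {-2}j (erefl (r - j)%N) S X => [|n IH] j rj S X jr Sj nSr XS; first by lia.
have pj : (0 < j <= r)%N by lia.
have [ej|nj] := eqVneq j r.-1.
  have [] := frameDC r3 cohC nSr XS (i := index1 pj); rewrite ?index1E -?ej //.
  move=> _ XS'; exists (refl (index1 pj) X); apply: frameC_good XS'.
    by rewrite /= ej swap_pen // -ej.
  by rewrite /= -ej /swap eqxx ej prednK //; lia.
have [] := frameD_low r3 cohC nSr XS (i := index1 pj); first by rewrite index1E; lia.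
rewrite index1E => _ XS'; apply: (IH j.+1 _ _ _ _ _ _ XS'); try lia.
  by rewrite /= /swap ifF ?eqxx //; lia.
by rewrite /= /swap !ifF //; lia.
Qed.

End GoodPoint.

(** * Transport along a permutation of the index set *)

Section Relabel.
Local Open Scope ring_scope.
Variables (r : nat) (s : {perm 'I_r}) (C : semi_cartan_graph r).
Implicit Types (i j k : 'I_r).

Lemma mul_mxsub_perm (u v : 'M[int]_r) :
  mxsub s s (u *m v) = mxsub s s u *m mxsub s s v.
Proof.
apply/matrixP=> k j; rewrite !mxE (reindex_inj (@perm_inj _ s)) /=.
by apply: eq_bigr => i _; rewrite !mxE.
Qed.

Lemma mxsub_perm1 : mxsub s s 1%:M = 1%:M :> 'M[int]_r.
Proof. by apply/matrixP=> k j; rewrite !mxE (inj_eq perm_inj). Qed.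

(** Relabelling is conjugation by a permutation matrix, so it respects products and inverses. *)
Lemma weyl_hom_relabel (X Y : point (relabel s C)) (w : 'M[int]_r) :
  weyl_hom X Y w ->
  exists2 u, @weyl_hom r C X Y u & w = mxsub s s u.
Proof.
elim=> [i Z|Z|Z Z' Z'' _ _ _ [u hu ->] _ [v hv ->]|Z Z' _ _ [u hu ->]].
- exists (@simple_refl r C (s i) Z); first exact: weyl_hom_gen.
  by apply/matrixP=> k j; rewrite !mxE /= ?mxE !(inj_eq perm_inj).
- by exists 1%:M; [exact: weyl_hom_id | rewrite mxsub_perm1].
- by exists (v *m u); [exact: weyl_hom_comp hu hv | rewrite mul_mxsub_perm].
exists (invmx u); first exact: weyl_hom_inv.
have uu := weyl_hom_unit hu.
have e : mxsub s s u *m mxsub s s (invmx u) = 1%:M.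
  by rewrite -mul_mxsub_perm mulmxV // mxsub_perm1.
by have [su _] := mulmx1_unit e; rewrite -[RHS](mulKmx su) e mulmx1.
Qed.

Lemma real_roots_relabel (X : point (relabel s C)) b :
  real_roots X b ->
  exists2 c, @real_roots r C X c & forall k, b k 0 = c (s k) 0.
Proof.
move=> [Y [w [i [/weyl_hom_relabel[u hu ->] ->]]]].
exists (u *m alpha (s i)); first by exists Y, u, (s i).
move=> k; rewrite !mxE [RHS](reindex_inj (@perm_inj _ s)) /=.
by apply: eq_bigr => j _; rewrite !mxE (inj_eq perm_inj).
Qed.

Lemma sign_coherent_relabel :
  (forall X : point C, sign_coherent (real_roots X)) ->
  forall X : point (relabel s C), sign_coherent (real_roots X).
Proof.
move=> coh X b /real_roots_relabel[c /coh[] c0 bc]; [left|right] => k.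
  by rewrite bc; exact: c0.
by have := c0 (s k); rewrite !mxE bc.
Qed.

Lemma connected_relabel : graph_connected C -> graph_connected (relabel s C).
Proof.
move=> conn S S0 Srefl; apply: conn => // i X.
by have := Srefl ((s^-1)%g i) X; rewrite /= permKV.
Qed.

Lemma equivalent_relabel : equivalent C (relabel s C).
Proof.
exists (s^-1)%g, id; split=> [|i X|X i j].
- by exists id.
- by rewrite /= permKV.
- by rewrite /= mxE !permKV.
Qed.

Lemma standard_of_type_relabel (T : 'M[int]_r) :
  (forall (X : point (relabel s C)) i j, cartan X i j = T i j) ->
  standard_of_type T C.
Proof.
move=> XT; split; last by exists s => X; apply/matrixP => i j; exact: XT.
have XE X i j : @cartan r C X i j = T ((s^-1)%g i) ((s^-1)%g j).
  by rewrite -(XT X) /= mxE !permKV.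
by move=> X Y; apply/matrixP => i j; rewrite !XE.
Qed.

End Relabel.

(** * Exclusivity of the alternatives and the final case analysis *)

Lemma standard_not_good r (C D : semi_cartan_graph r) (Y : point D) :
  standard C -> equivalent C D -> ~ good_D'_neighborhood Y.
Proof.
move=> stC [s [f [[g fK gK] _ fA]]].
have stD (X Z : point D) : cartan X = cartan Z.
  apply/matrixP => i j; rewrite -(gK X) -(gK Z) -(permKV s i) -(permKV s j).
  by rewrite !fA (stC (g X) (g Z)).
move=> [t [i1 [i2 [i3 [i4 [[e1 e2 e3 e4] [a [_ _]]]]]]]] /= A2 A3 _.
(* A standard graph has one matrix at both neighbours, but the triangle has -1 at (1, 3) and the
   chain has 0. *)
have : triangle_mx r i1 i3 = chain_mx r a i1 i3.
  by rewrite -A2 -A3 !mxE (stD (refl (t i2) Y) (refl (t i3) Y)).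
by rewrite !mxE e1 e3.
Qed.

Theorem theorem3p11 (r : nat) (C : semi_cartan_graph r) :
  5 <= r ->
  graph_connected C -> cartan_graph C -> graph_finite C -> non_sporadic C ->
  let alt1 :=
    [\/ standard_of_type (cartanA r) C, standard_of_type (cartanB r) C,
        standard_of_type (cartanC r) C | standard_of_type (cartanD r) C] in
  let alt2 :=
    exists D : semi_cartan_graph r,
      equivalent C D /\ exists Y : point D, good_D'_neighborhood Y in
  (alt1 /\ ~ alt2) \/ (~ alt1 /\ alt2).
Proof.
move=> r5 conn [coh _] _ [s [X XP]] alt1 alt2.
suff : alt1 \/ alt2.
  have excl : alt1 -> ~ alt2.
    by move=> [] [st _] [D [CD [Y]]]; exact: standard_not_good st CD.
  case=> h; [left | right]; split=> //; first exact: excl.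
  by move=> /excl; apply.
have r4 : 3 < r by lia.
have connS := @connected_relabel r s C conn.
have cohS := @sign_coherent_relabel r s C coh.
have good : (exists Y : point (relabel s C), good_D'_neighborhood Y) -> alt2.
  by move=> ?; exists (relabel s C); split=> //; exact: equivalent_relabel.
have XN := @real_roots_opp r (relabel s C) X.
case: XP => [XA|XB|[Z Zr XZ]|[Y Yr XY]].
- left; apply: Or41; apply: (standard_of_type_relabel (s := s)) => Y i j.
  rewrite cartanA_row //.
  apply: (standard_frame cohS (F := frameA r) (row := rowA) connS).
  + by apply: frameA_admissible; lia.
  + by move=> p pr; apply: rowA_is_row; lia.
  + by move=> p f pr _ fr; exact: reflect_frameA.
  + apply: (roots_frame _ XA (cohS X) (XN)) => b.
    by apply: pos_rootsA_ecoord; lia.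
- left; apply: Or42; apply: (standard_of_type_relabel (s := s)) => Y i j.
  rewrite cartanB_row //.
  apply: (standard_frame cohS (F := frameB r) (row := rowB r) connS).
  + by apply: frameB_admissible; lia.
  + by move=> p pr; apply: rowB_is_row; lia.
  + by move=> p f pr _ fr; apply: reflect_frameB => //; lia.
  + apply: (roots_frame _ XB (cohS X) (XN)) => b.
    by apply: pos_rootsB_ecoord; lia.
- have XD : roots_at X (frameD r [pred j | j \in Z]).
    apply: (roots_frame _ XZ (cohS X) (XN)) => b.
    by apply: Phi_ecoord => //; lia.
  have nZr : r \notin Z by apply/negP => /Zr; rewrite inE ltnn andbF.
  (* A nonempty Z leads to a good point, while the empty Z gives type D. *)
  have [[j jZ]|Z0] := pselect (exists j, j \in Z).
    right; apply: good; have := Zr _ jZ; rewrite inE => jr.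
    exact: (frameD_walk r5 cohS jr _ _ XD).
  have {}XD : roots_at X (frameD r xpred0).
    move=> b; rewrite XD; apply: eq_frame => k _ /=.
    by apply/negP => kZ; apply: Z0; exists k.
  left; apply: Or44; apply: (standard_of_type_relabel (s := s)) => Y i j.
  rewrite cartanD_row //.
  apply: (standard_frame cohS (F := frameD r xpred0) (row := rowD r false) connS) => //.
  + by apply: frameD_admissible => //; lia.
  + by move=> p pr; apply: rowD_is_row; lia.
  move=> p f pr _ fr; have [plow|] := ltnP p r.-1.
    (* [xpred0 \o swap p] is convertible to [xpred0], so both sides agree after the rewrite. *)
    by rewrite [X in X <-> _](@reflect_frameD r xpred0 false p) //; lia.
  have [->|np] := eqVneq p r => pge.
    by rewrite [X in X <-> _]reflect_frameD_last //; lia.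
  have -> : p = r.-1 by lia.
  by rewrite [X in X <-> _]reflect_frameD_pen //; lia.
have XC : roots_at X (frameC r [pred j | (j \in Y) || (j == r)]).
  apply: (roots_frame _ XY (cohS X) (XN)) => b.
  by apply: Psi_ecoord => //; lia.
(* An index below r missing from Y leads to a good point, while the full Y gives type C. *)
have [[j [jr jY]]|Yall] := pselect (exists j, 0 < j < r /\ j \notin Y).
  right; apply: good; apply: (frameC_walk r5 cohS jr _ _ XC) => /=.
    by rewrite (negbTE jY) /=; lia.
  by rewrite eqxx orbT.
have {}XC : roots_at X (frameC r xpredT).
  move=> b; rewrite XC; apply: eq_frame => k kr /=; apply/orP.
  have [->|nk] := eqVneq k r; [by right | left].
  by apply/negP => /negP kY; apply: Yall; exists k; split=> //; lia.
left; apply: Or43; apply: (standard_of_type_relabel (s := s)) => Z i j.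
rewrite cartanC_row //.
apply: (standard_frame cohS (F := frameC r xpredT) (row := rowC r true) connS) => //.
+ by apply: frameC_admissible => //; lia.
+ by move=> p pr; apply: rowC_is_row; lia.
move=> p f pr _ fr; have [plow|] := ltnP p r.-1.
  by rewrite [X in X <-> _](@reflect_frameC r xpredT true p) //; lia.
have [->|np] := eqVneq p r => pge.
  by rewrite [X in X <-> _](@reflect_frameC_last r xpredT true) //; lia.
have -> : p = r.-1 by lia.
by rewrite [X in X <-> _]reflect_frameC_full //; lia.
Qed.
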